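(* The number of uniquely realizable net-degree sequences of bidirected graphs on $n$ nodes (labelled $1,\dots,n$) is \[ 2^n\binom{n}{2}+2^n . \]
   Context: A bidirected graph (bigraph) is a pair $B=(G,\tau)$ where $G=(V,E)$ is a finite simple undirected graph (no loops, no parallel edges) and $\tau:V\times E\to\{-1,0,1\}$ satisfies $\tau(v,e)\in\{-1,1\}$ if $v$ is incident to $e$ and $\tau(v,e)=0$ otherwise. Here the node set is $V=[n]=\{1,\dots,n\}$. The net-degree sequence of $B$ is $\mathbf d(B)\in\mathbb Z^n$ with $\mathbf d(B)_v=\sum_{e\in E}\tau(v,e)$. A vector $\mathbf d\in\mathbb Z^n$ is a uniquely realizable net-degree sequence if there is exactly one bigraph $B$ on the node set $[n]$ with $\mathbf d(B)=\mathbf d$.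
   Formalization: The count is proved for n ≥ 3 nodes; the formula fails for n = 1 (one sequence, formula gives 2) and n = 2 (five sequences, formula gives 8). *)

(* Defs.v *)
From mathcomp Require Import all_boot all_algebra.
From mathcomp Require Import boolp classical_sets functions cardinality.

Set Implicit Arguments.
Unset Strict Implicit.
Unset Printing Implicit Defensive.

Import GRing.Theory.
Local Open Scope ring_scope.

(* The node set {1, ..., n} is 'I_n, i.e. shifted to {0, ..., n-1}.  An edge is
   the two-element set of its endpoints, so there are no loops and no parallel
   edges; v is incident to e iff v \in e.  The side conditions are boolean,
   hence proof-irrelevant: two bigraphs are equal iff they have the same edges
   and the same bidirection, and [exists!] below counts labelled bigraphs. *)
Record bigraph (n : nat) : Type := Bigraph {
  edges : {set {set 'I_n}};
  bidirection : {ffun 'I_n * {e : {set 'I_n} | e \in edges} -> int};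
  edges_card2 : [forall e in edges, #|e| == 2%N];
  bidirection_sign :
    [forall v : 'I_n, forall e : {e : {set 'I_n} | e \in edges},
       if v \in val e then bidirection (v, e) \in [:: -1; 1]
       else bidirection (v, e) == 0]
}.

Definition net_degree (n : nat) (B : bigraph n) : 'rV[int]_n :=
  \row_v \sum_(e : {e : {set 'I_n} | e \in edges B}) bidirection B (v, e).

Definition uniquely_realizable (n : nat) (d : 'rV[int]_n) : Prop :=
  exists! B : bigraph n, net_degree B = d.

(* Main.v *)
Require Import Defs.
From mathcomp Require Import all_boot all_algebra.
From mathcomp Require Import boolp classical_sets functions cardinality.
From mathcomp Require Import zify.

(** A bigraph is a matrix of half-edge signs in {-1,0,1} with zero diagonal and
    symmetric support, and its net-degrees are the row sums.  If it is the only
    one with its row sums, then local exchanges of half-edges preserving the row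
    sums are impossible: two opposite half-edges at a node could be swapped, two
    nonedges at a node could be exchanged with the third side of the triangle,
    and two disjoint nonedges could be switched along an alternating 4-cycle.
    So every node carries a single sign and the graph is complete up to one
    missing edge.  Conversely the row sums of such a bigraph are extremal enough
    to determine it, and for n > 2 they determine the signs and the missing edge:
    this leaves 2^n * ('C(n, 2) + 1) sequences. *)

Local Open Scope classical_set_scope.
Local Open Scope card_scope.

Section HalfEdgeMatrices.

Local Set Implicit Arguments.
Local Unset Strict Implicit.

Import GRing.Theory Num.Theory.
Local Open Scope ring_scope.

(** * Bigraphs as half-edge matrices *)

Definition half_edge_mx (n : nat) (M : 'M[int]_n) : Prop :=
  [/\ forall u v, M u v \in [:: -1; 0; 1],
      forall u v, (M u v == 0) = (M v u == 0)
    & forall u, M u u = 0].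

Definition row_sums (n : nat) (M : 'M[int]_n) : 'rV[int]_n :=
  \row_u \sum_v M u v.

(** The default [0] covers nonedges. For [u = v] the set [[set u; v]] is a singleton, hence never an
    edge, so the diagonal vanishes. *)
Definition mx_of_bigraph (n : nat) (B : bigraph n) : 'M[int]_n :=
  \matrix_(u, v)
    oapp (fun e => bidirection B (u, e)) 0 (insub [set u; v]%SET).

Lemma set2_injr (T : finType) (x : T) : injective (fun y => [set x; y]%SET).
Proof.
move=> y z /setP E; have := E y; have := E z.
rewrite !inE !eqxx !orbT; case: (eqVneq y x) => [->|_] /=.
  by rewrite orbb => /eqP.
by move=> _ /esym/eqP.
Qed.

Lemma edgeP (n : nat) (B : bigraph n) (v : 'I_n)
    (e : {e : {set 'I_n} | e \in edges B}) :
  v \in val e -> exists2 u, u != v & val e = [set v; u]%SET.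
Proof.
move=> ve; have /forall_inP/(_ _ (valP e))/cards2P[x [y [xy E]]] := edges_card2 B.
by move: ve; rewrite E !inE => /orP[]/eqP->;
  [exists y; rewrite // eq_sym | exists x; rewrite // finset.setUC].
Qed.

Lemma mx_of_bigraphE (n : nat) (B : bigraph n) (u v : 'I_n)
    (e : {e : {set 'I_n} | e \in edges B}) :
  val e = [set u; v]%SET -> mx_of_bigraph B u v = bidirection B (u, e).
Proof. by rewrite mxE => <-; rewrite valK. Qed.

Lemma bidirection_in (n : nat) (B : bigraph n) (v : 'I_n)
    (e : {e : {set 'I_n} | e \in edges B}) :
  v \in val e -> bidirection B (v, e) \in [:: -1; 1].
Proof.
by move=> ve; move: (bidirection_sign B) => /forallP/(_ v)/forallP/(_ e); rewrite ve.
Qed.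

Lemma bidirection_notin (n : nat) (B : bigraph n) (v : 'I_n)
    (e : {e : {set 'I_n} | e \in edges B}) :
  v \notin val e -> bidirection B (v, e) = 0.
Proof.
move=> /negPf ve.
by move: (bidirection_sign B) => /forallP/(_ v)/forallP/(_ e); rewrite ve => /eqP.
Qed.

Lemma mx_of_bigraph_edge (n : nat) (B : bigraph n) (u v : 'I_n) :
  if [set u; v]%SET \in edges B then mx_of_bigraph B u v \in [:: -1; 1]
  else mx_of_bigraph B u v == 0.
Proof.
rewrite mxE; case: insubP => [e -> E|/negPf ->] //=.
by apply: bidirection_in; rewrite E !inE eqxx.
Qed.

Lemma mx_of_bigraph_neq0 (n : nat) (B : bigraph n) (u v : 'I_n) :
  (mx_of_bigraph B u v != 0) = ([set u; v]%SET \in edges B).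
Proof.
have := mx_of_bigraph_edge B u v; case: ifP => _; last by move->.
by rewrite !inE => /orP[]/eqP->.
Qed.

Lemma half_edge_mx_of_bigraph (n : nat) (B : bigraph n) :
  half_edge_mx (mx_of_bigraph B).
Proof.
split=> [u v|u v|u].
- have := mx_of_bigraph_edge B u v; case: ifP => _; rewrite !inE; last by move=> ->; rewrite ?orbT.
  by case/orP=> ->; rewrite ?orbT.
- by apply: negb_inj; rewrite !mx_of_bigraph_neq0 finset.setUC.
- apply/eqP; rewrite -[_ == _]negbK mx_of_bigraph_neq0 finset.setUid.
  apply/negP=> uB; move: (edges_card2 B) => /forall_inP/(_ _ uB).
  by rewrite cards1.
Qed.

Lemma net_degreeE (n : nat) (B : bigraph n) :
  net_degree B = row_sums (mx_of_bigraph B).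
Proof.
apply/rowP => u; rewrite !mxE.
rewrite (bigID (fun e : {e | e \in edges B} => u \in val e)) /=.
rewrite [X in _ + X]big1 ?addr0; last by move=> e; apply: bidirection_notin.
rewrite [RHS](bigID (fun v => [set u; v]%SET \in edges B)) /=.
rewrite [X in _ = _ + X]big1 ?addr0; last first.
  by move=> v; rewrite -mx_of_bigraph_neq0 negbK => /eqP.
(* The columns [v] are grouped by the edge they span with [u]; this edge determines [v], so each
   group is a single term. *)
rewrite (partition_big (fun v => insub [set u; v]%SET : option {e | e \in edges B})
  (fun oe => if oe is Some e then u \in val e else false)) /=; last first.
  by move=> v uv; rewrite insubT /= !inE eqxx.
rewrite (reindex_omap Some id) /=; last by case.
apply: eq_big => [e|e ue]; first by rewrite eqxx andbT.
have [v _ E] := edgeP ue.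
rewrite (big_pred1 v) ?(mx_of_bigraphE E) // => w /=.
apply/andP/eqP => [[uw /eqP]|->].
  rewrite insubT => -[] /(congr1 val) /=; rewrite E; exact: set2_injr.
by rewrite -E (valP e) valK.
Qed.

(** The support gives the edge set, which has to be identified first because the type of
    [bidirection] depends on it; the entries then give the signs. *)
Lemma mx_of_bigraph_inj (n : nat) : injective (@mx_of_bigraph n).
Proof.
move=> B B' E.
have Eedges : edges B = edges B'.
  apply/setP => e; apply/idP/idP => eB.
    have /forall_inP/(_ _ eB)/cards2P[u [v [_ Ee]]] := edges_card2 B.
    by rewrite Ee -mx_of_bigraph_neq0 -E mx_of_bigraph_neq0 -Ee.
  have /forall_inP/(_ _ eB)/cards2P[u [v [_ Ee]]] := edges_card2 B'.
  by rewrite Ee -mx_of_bigraph_neq0 E mx_of_bigraph_neq0 -Ee.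
have Ebi (v : 'I_n) (e : {set 'I_n}) (eB : e \in edges B) (eB' : e \in edges B') :
    bidirection B (v, exist _ e eB) = bidirection B' (v, exist _ e eB').
  have [ve|ve] := boolP (v \in e); last by rewrite !bidirection_notin.
  have [u _ /= Ee] := @edgeP _ B v (exist _ e eB) ve.
  rewrite -(@mx_of_bigraphE _ B v u (exist _ e eB) Ee).
  by rewrite -(@mx_of_bigraphE _ B' v u (exist _ e eB') Ee) E.
clear E; case: B B' Eedges Ebi => [E b c s] [E' b' c' s'] /= EE.
subst E' => Ebi.
have ? : b = b' by apply/ffunP => -[v [e eE]]; apply: Ebi.
by subst b'; rewrite (bool_irrelevance c c') (bool_irrelevance s s').
Qed.

Lemma mx_of_bigraph_onto (n : nat) (M : 'M[int]_n) :
  half_edge_mx M -> exists B, mx_of_bigraph B = M.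
Proof.
move=> [Mval Msym Mdiag].
pose E := [set [set p.1; p.2]%SET | p : 'I_n * 'I_n in [pred p | M p.1 p.2 != 0]]%SET.
have inE2 u v : ([set u; v]%SET \in E) = (M u v != 0).
  apply/imsetP/idP => [[[a b] /= ab /setP S]|uv]; last by exists (u, v).
  rewrite inE /= in ab.
  have ab' : a != b by apply: contraNneq ab => ->; rewrite Mdiag.
  have := S a; have := S b; have := S u; have := S v; rewrite !inE !eqxx !orbT /=.
  move=> /esym/orP[]/eqP-> /esym/orP[]/eqP->; rewrite ?orbb //.
  - by move=> /eqP ba; rewrite ba eqxx in ab'.
  - by rewrite Msym.
  - by move=> _ /eqP ba; rewrite ba eqxx in ab'.
have EP e v : e \in E -> v \in e -> exists2 u, e = [set v; u]%SET & M v u != 0.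
  move=> /imsetP[[a b] /= ab ->]; rewrite inE /= in ab.
  by rewrite !inE => /orP[]/eqP->; [exists b | exists a; rewrite 1?finset.setUC // Msym].
(* The sum has one term if [p.1] is an endpoint of the edge and none otherwise: it reads off the
   other endpoint without choosing it, with default 0. *)
pose b := [ffun p : 'I_n * {e : {set 'I_n} | e \in E} =>
  \sum_(u | [set p.1; u]%SET == val p.2) M p.1 u].
have bE u v e : val e = [set u; v]%SET -> b (u, e) = M u v.
  move=> Ee; rewrite ffunE /= (big_pred1 v) // => w; rewrite Ee.
  by apply/eqP/eqP => [|-> //]; apply: set2_injr.
have Ecard : [forall e in E, #|e| == 2%N].
  apply/forall_inP => e /imsetP[[u v] /= uv ->]; rewrite inE /= in uv.
  suff -> : #|[set u; v]%SET| = 2%N by [].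
  by apply/eqP; rewrite cards2 eqSS eqb1; apply: contraNneq uv => ->; rewrite Mdiag.
have bsign : [forall v : 'I_n, forall e : {e : {set 'I_n} | e \in E},
    if v \in val e then b (v, e) \in [:: -1; 1] else b (v, e) == 0].
  apply/forallP => v; apply/forallP => e; case: ifPn => ve.
    have [u Ee vu] := EP _ _ (valP e) ve; rewrite (bE _ _ _ Ee).
    by have := Mval v u; move: vu; rewrite !inE => /negPf ->.
  rewrite ffunE /= big_pred0 // => u; apply: contraNF ve => /eqP E2.
  by have <- : [set v; u]%SET = val e by []; rewrite !inE eqxx.
exists (Bigraph Ecard bsign); apply/matrixP => u v; rewrite mxE.
case: insubP => [e _ Ee|] /=; first exact: bE.
by rewrite inE2 negbK => /eqP.
Qed.

Definition realizes_uniquely (n : nat) (M : 'M[int]_n) : Prop :=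
  half_edge_mx M /\
  forall N, half_edge_mx N -> row_sums N = row_sums M -> N = M.

(** Transports uniqueness along the bijection between bigraphs and half-edge matrices, so that only
    matrices have to be studied. *)
Lemma uniquely_realizableP (n : nat) (d : 'rV[int]_n) :
  uniquely_realizable d <->
  exists2 M, realizes_uniquely M & row_sums M = d.
Proof.
split=> [[B [Bd Buniq]]|[M [hM Muniq] Md]].
  exists (mx_of_bigraph B); last by rewrite -net_degreeE.
  split=> [|N hN]; first exact: half_edge_mx_of_bigraph.
  have [B' <-] := mx_of_bigraph_onto hN; rewrite -!net_degreeE Bd => B'd.
  by rewrite (Buniq _ B'd).
have [B BM] := mx_of_bigraph_onto hM; exists B.
split=> [|B' B'd]; first by rewrite net_degreeE BM.
apply: mx_of_bigraph_inj; rewrite BM; apply/esym/Muniq; first exact: half_edge_mx_of_bigraph.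
by rewrite -net_degreeE B'd.
Qed.

(** * Exchanges that preserve the row sums *)

Definition transfer (n : nat) (u v w : 'I_n) (c : int) : 'M[int]_n :=
  c *: (delta_mx u v - delta_mx u w).

Lemma row_sumsD (n : nat) (M N : 'M[int]_n) :
  row_sums (M + N) = row_sums M + row_sums N.
Proof.
by apply/rowP => u; rewrite !mxE -big_split; apply: eq_bigr => v _; rewrite mxE.
Qed.

Lemma row_sums_transfer (n : nat) (u v w : 'I_n) (c : int) :
  row_sums (transfer u v w c) = 0.
Proof.
have sum_delta a x : \sum_b delta_mx u x a b = (a == u)%:R :> int.
  rewrite (bigD1 x) //= big1 ?addr0 ?mxE ?eqxx ?andbT // => b bx.
  by rewrite mxE (negPf bx) andbF.
have transferE a b :
    transfer u v w c a b = c * (delta_mx u v a b - delta_mx u w a b) by rewrite !mxE.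
apply/rowP => a; rewrite !mxE; under eq_bigr => b _ do rewrite transferE.
by rewrite -mulr_sumr sumrB !sum_delta subrr mulr0.
Qed.

(** The form in which uniqueness is exploited: each exchange [E] below is a sum of transfers with a
    visibly nonzero entry. *)
Lemma realizes_uniquelyD (n : nat) (M E : 'M[int]_n) :
  realizes_uniquely M -> row_sums E = 0 -> half_edge_mx (M + E) -> E = 0.
Proof.
move=> [_ Muniq] E0 hME.
have /(congr1 (fun N => N - M)) : M + E = M by apply: Muniq; rewrite ?row_sumsD ?E0 ?addr0.
by rewrite addrC addKr subrr.
Qed.

Lemma half_edge_mxP (n : nat) (M : 'M[int]_n) :
  (forall u, M u u = 0) ->
  (forall u v, M u v \in [:: -1; 0; 1] /\ (M u v == 0) = (M v u == 0)) ->
  half_edge_mx M.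
Proof. by move=> M0 H; split=> // u v; have [] := H u v. Qed.

Ltac case_eqs x u v w := case: (eqVneq x u) => [->|_];
  [|case: (eqVneq x v) => [->|_]; [|case: (eqVneq x w) => [->|_]]].

Section UniqueRealization.

Variables (n : nat) (M : 'M[int]_n).
Hypothesis Muniq : realizes_uniquely M.

Let Mval u v : M u v \in [:: -1; 0; 1]. Proof. by have [[]] := Muniq. Qed.
Let Msym u v : (M u v == 0) = (M v u == 0). Proof. by have [[]] := Muniq. Qed.
Let Mdiag u : M u u = 0. Proof. by have [[]] := Muniq. Qed.
Let MdiagF u v : M u v != 0 -> (u == v) = false.
Proof. by move=> uv; apply: contraNF uv => /eqP->; rewrite Mdiag. Qed.

(* Otherwise the two opposite half-edges at [v] could be exchanged. *)
Lemma unique_half_edges_agree (u v w : 'I_n) : M v u = 1 -> M v w = -1 -> False.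
Proof.
move=> vu vw.
have Dvu : (v == u) = false by apply: MdiagF; rewrite vu.
have Dvw : (v == w) = false by apply: MdiagF; rewrite vw.
have Duw : (u == w) = false by apply/eqP => uw; rewrite uw vw in vu.
have D := (Dvu, Dvw, Duw, etrans (eq_sym _ _) Dvu, etrans (eq_sym _ _) Dvw,
  etrans (eq_sym _ _) Duw, eqxx).
(* The factor [-2] turns 1 into -1 at [(v, u)] and -1 into 1 at [(v, w)]; the support does not
   change. *)
suff /matrixP/(_ v u) : transfer v u w (-2) = 0 by rewrite !mxE !D.
apply: (realizes_uniquelyD Muniq); first exact: row_sums_transfer.
apply: half_edge_mxP => [a|a b]; rewrite !mxE.
  by case_eqs a u v w; rewrite ?D ?Mdiag //= ?mulr0 ?addr0 ?Mdiag.
have uv0 := Msym v u; have wv0 := Msym v w.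
rewrite vu vw in uv0 wv0; have := Mval a b; have := Msym a b.
case_eqs a u v w; case_eqs b u v w; rewrite ?D /= ?(vu, vw) -?(uv0, wv0)
  ?andbF ?subrr ?mulr0 ?addr0 -?uv0 -?wv0 //.
Qed.

(* Otherwise the nonedges uv, vw and the pair uw (edge or not) could be exchanged
   with their complements, [v] receiving two opposite half-edges. *)
Lemma unique_nonedges_matching (u v w : 'I_n) :
  v != u -> v != w -> M v u = 0 -> M v w = 0 -> u = w.
Proof.
move=> /negPf Dvu /negPf Dvw vu vw; apply/eqP/negPn/negP => /negPf Duw.
have D := (Dvu, Dvw, Duw, etrans (eq_sym _ _) Dvu, etrans (eq_sym _ _) Dvw,
  etrans (eq_sym _ _) Duw, eqxx).
have uv : M u v = 0 by apply/eqP; rewrite Msym vu.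
have wv : M w v = 0 by apply/eqP; rewrite Msym vw.
(* With this coefficient an edge [uw] is deleted and its signs move to [uv] and [wv]; a nonedge [uw]
   becomes an edge with both signs -1, compensated by 1 on [uv] and [wv]. *)
pose s x y : int := if M x y == 0 then 1 else M x y.
pose E := transfer u v w (s u w) + transfer w v u (s w u) + transfer v u w 1.
suff /matrixP/(_ v u) : E = 0.
  by rewrite !mxE !D /= !(subrr, mulr0, add0r).
apply: (realizes_uniquelyD Muniq); first by rewrite !row_sumsD !row_sums_transfer !addr0.
apply: half_edge_mxP => [a|a b]; rewrite !mxE.
  by case_eqs a u v w; rewrite ?D ?Mdiag //= ?andbF ?subrr ?mulr0 ?addr0 ?Mdiag.
rewrite /s; have := Msym u w; have := Mval u w; have := Mval w u.
have := Mval a b; have := Msym a b; rewrite !inE.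
case_eqs a u v w; case_eqs b u v w; rewrite ?D /= ?(vu, vw, uv, wv)
  ?andbF ?subrr ?mulr0 ?addr0 // => _ _ /or3P[]/eqP-> /or3P[]/eqP-> // _;
  split.
Qed.

(* Otherwise uw, vx could be exchanged with the nonedges uv, wx. *)
Lemma unique_nonedges_meet (u v w x : 'I_n) :
  u != v -> w != x -> M u v = 0 -> M w x = 0 -> M u w != 0 -> M v x != 0 -> False.
Proof.
move=> /negPf Duv /negPf Dwx uv wx uw vx.
have vu : M v u = 0 by apply/eqP; rewrite Msym uv.
have xw : M x w = 0 by apply/eqP; rewrite Msym wx.
have wu : M w u != 0 by rewrite Msym.
have xv : M x v != 0 by rewrite Msym.
have Duw := MdiagF uw; have Dvx := MdiagF vx.
have Dux : (u == x) = false by apply: contraNF vx => /eqP <-; rewrite vu.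
have Dvw : (v == w) = false by apply: contraNF vx => /eqP ->; rewrite wx.
have D := (Duv, Dwx, Duw, Dvx, Dux, Dvw, etrans (eq_sym _ _) Duv, etrans (eq_sym _ _) Dwx,
  etrans (eq_sym _ _) Duw, etrans (eq_sym _ _) Dvx, etrans (eq_sym _ _) Dux,
  etrans (eq_sym _ _) Dvw, eqxx).
(* Each of the four nodes moves its half-edge, sign included, from its old neighbour to its new
   one. *)
pose E := transfer u v w (M u w) + transfer w x u (M w u) +
  transfer x w v (M x v) + transfer v u x (M v x).
suff /matrixP/(_ u v) : E = 0.
  by rewrite !mxE !D /= !(subr0, subrr, mulr0, mulr1, addr0) => /eqP; apply/negP.
apply: (realizes_uniquelyD Muniq); first by rewrite !row_sumsD !row_sums_transfer !addr0.
apply: half_edge_mxP => [a|a b]; rewrite !mxE.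
  by (case: (eqVneq a x) => [->|_]; last case_eqs a u v w);
    rewrite ?D ?Mdiag //= ?andbF ?subrr ?mulr0 ?addr0 ?Mdiag.
have := Mval a b; have := Msym a b.
(case: (eqVneq a x) => [->|_]; last case_eqs a u v w);
  (case: (eqVneq b x) => [->|_]; last case_eqs b u v w);
  rewrite ?D /= ?(vu, uv, wx, xw)
  ?andbF ?(subrr, mulr0, mulr1, sub0r, subr0, mulrN, addr0, add0r) ?eqxx // => _ _;
  by rewrite Mval ?(negPf uw, negPf vx, negPf wu, negPf xv).
Qed.

(** If [uv] were an edge, the switch would force [u'v'] to be a nonedge or [u' = v']. In the latter
    case [u'] misses both [u] and [v], so [u = v]; in the former it misses [u] and [v'], so [u = v']
    and [uv] is a nonedge after all. *)
Lemma unique_nonedges_eq0 (u u' v v' : 'I_n) :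
  u != v -> u != u' -> v != v' -> M u u' = 0 -> M v v' = 0 -> M u v = 0.
Proof.
move=> uv uu' vv' Muu' Mvv'; apply/eqP/negPn/negP => Muv.
have Mu'u : M u' u = 0 by apply/eqP; rewrite Msym Muu'.
have Mv'v : M v' v = 0 by apply/eqP; rewrite Msym Mvv'.
apply: (unique_nonedges_meet uu' vv') => //; apply/negP => /eqP Mu'v'.
have [u'v'|u'v'] := eqVneq u' v'.
  subst v'; move: uv; rewrite (unique_nonedges_matching _ _ Mu'u Mv'v) ?eqxx //;
  by rewrite eq_sym.
have uv' : u = v' by apply: (@unique_nonedges_matching _ u'); rewrite // eq_sym.
by move: Muv; rewrite Msym uv' Mvv' eqxx.
Qed.

End UniqueRealization.

(** * Extremal matrices: classification and uniqueness *)

(* Complete graph minus the pairs inside [A], with sign [(-1) ^+ s u] at every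
   half-edge of [u]; [A] is empty or consists of the ends of the missing edge. *)
Definition extremal_mx (n : nat) (s : {ffun 'I_n -> bool}) (A : {set 'I_n}) : 'M[int]_n :=
  \matrix_(u, v) if (u == v) || (u \in A) && (v \in A) then 0 else (-1) ^+ s u.

Definition empty_or_pair (n : nat) (A : {set 'I_n}) : bool :=
  (#|A| == 0%N) || (#|A| == 2%N).

(** Take for [A] the nodes with a nonneighbour. They are pairwise nonadjacent, and each has only one
    nonneighbour, so [A] is empty or a pair. *)
Lemma realizes_uniquely_extremal (n : nat) (M : 'M[int]_n) :
  realizes_uniquely M -> exists s A, empty_or_pair A /\ M = extremal_mx s A.
Proof.
move=> Muniq; have [[Mval Msym Mdiag] _] := Muniq.
pose A := [set u | [exists v, (u != v) && (M u v == 0)]]%SET.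
(* A node without half-edges gets [false]; its sign never shows in the matrix. *)
pose s := [ffun u => [exists v, M u v == -1]].
have inA u v : u != v -> M u v = 0 -> u \in A.
  by move=> uv Muv; rewrite inE; apply/existsP; exists v; rewrite uv Muv eqxx.
have MA u v : u \in A -> v \in A -> u != v -> M u v = 0.
  rewrite !inE => /existsP[u' /andP[uu' /eqP Muu']] /existsP[v' /andP[vv' /eqP Mvv']] uv.
  exact: (unique_nonedges_eq0 Muniq uv uu' vv').
exists s, A; split.
  have [->|[u uA]] := set_0Vmem A; first by rewrite /empty_or_pair cards0.
  have := uA; rewrite inE => /existsP[v /andP[uv /eqP Muv]].
  suff -> : A = [set u; v]%SET by rewrite /empty_or_pair cards2 uv.
  apply/setP => w; rewrite !inE; apply/idP/orP => [|[]/eqP->].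
  - move=> wA; have [->|wu] := eqVneq w u; first by left.
    right; apply/eqP; apply: (unique_nonedges_matching Muniq (v := u)) => //.
      by rewrite eq_sym.
    by apply: MA; rewrite // ?inE // eq_sym.
  - by move: uA; rewrite inE.
  - have := inA v u; rewrite inE; apply; first by rewrite eq_sym.
    by apply/eqP; rewrite Msym Muv.
apply/matrixP => u v; rewrite !mxE; have [->|uv] := eqVneq u v; first exact: Mdiag.
case: ifPn => [/andP[uA vA]|nA]; first exact: MA.
have Muv : M u v != 0.
  apply: contraNneq nA => Muv; rewrite (inA u v) //= (inA v u) // 1?eq_sym //.
  by apply/eqP; rewrite Msym Muv.
rewrite ffunE; have := Mval u v; rewrite !inE (negPf Muv) /= => /orP[]/eqP Euv.
  by rewrite Euv; case: existsP => // -[]; exists v; rewrite Euv.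
rewrite Euv; case: existsP => // -[w /eqP uw].
by case: (unique_half_edges_agree Muniq Euv uw).
Qed.

(** The degree is [n.-1], less one at an end of the missing edge. When [A] is a pair, [n] is at
    least 2 and the subtraction in [nat] is not truncated. *)
Definition extremal_seq (n : nat) (s : {ffun 'I_n -> bool}) (A : {set 'I_n}) : 'rV[int]_n :=
  \row_u ((-1) ^+ s u * (n.-1 - (u \in A))%:Z).

Lemma half_edge_extremal (n : nat) (s : {ffun 'I_n -> bool}) (A : {set 'I_n}) :
  half_edge_mx (extremal_mx s A).
Proof.
apply: half_edge_mxP => [u|u v]; rewrite !mxE ?eqxx //.
rewrite [v == u]eq_sym [(v \in A) && _]andbC.
by case: ifP => _ //; case: (s u); case: (s v).
Qed.

Lemma row_sums_extremal (n : nat) (s : {ffun 'I_n -> bool}) (A : {set 'I_n}) :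
  empty_or_pair A -> row_sums (extremal_mx s A) = extremal_seq s A.
Proof.
move=> hA; apply/rowP => u; rewrite !mxE.
transitivity (\sum_(v | ~~ ((u == v) || (u \in A) && (v \in A))) ((-1) ^+ s u : int)).
  rewrite [RHS]big_mkcond; apply: eq_bigr => v _.
  by rewrite mxE; case: ifP.
rewrite sumr_const -mulr_natr natz; congr (_ * _%:Z).
have [uA|uA] /= := boolP (u \in A).
  have A2 : #|A| = 2%N.
    by case/orP: hA => /eqP // A0; move: uA; rewrite (cards0_eq A0) inE.
  transitivity #|~: A|%SET; last by rewrite cardsCs finset.setCK card_ord A2; lia.
  by apply: eq_card => v; rewrite !inE [LHS]unfold_in; case: (eqVneq u v) => [<-|_]; rewrite ?uA.
transitivity #|~: [set u]|%SET; last by rewrite cardsC1 card_ord subn0.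
by apply: eq_card => v; rewrite !inE [LHS]unfold_in orbF eq_sym.
Qed.

Lemma extremal_realizes_uniquely (n : nat) (s : {ffun 'I_n -> bool}) (A : {set 'I_n}) :
  empty_or_pair A -> realizes_uniquely (extremal_mx s A).
Proof.
move=> hA; split=> [|N [Nval Nsym Ndiag] /rowP NX]; first exact: half_edge_extremal.
set X := extremal_mx s A in NX *.
(* The deficit of [N] against [X], measured in the direction of the sign of [u]. It sums to 0 on
   each row and is nonnegative wherever [X] is extremal, that is, outside the pairs inside [A]. *)
pose t u v : int := (-1) ^+ s u * (X u v - N u v).
have t_sum u : \sum_v t u v = 0.
  by rewrite -mulr_sumr sumrB; have := NX u; rewrite !mxE => ->; rewrite subrr mulr0.
have tE u v : t u v = 0 -> N u v = X u v.
  by move=> /eqP; rewrite mulf_eq0 signr_eq0 subr_eq0 => /eqP.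
have t_ge0 u v : ~~ ((u \in A) && (v \in A)) -> 0 <= t u v.
  move=> /negPf uvA; rewrite /t !mxE uvA orbF; case: (eqVneq u v) => [->|_].
    by rewrite Ndiag subrr mulr0.
  by have := Nval u v; rewrite !inE => /or3P[]/eqP->; case: (s u).
have NXout u v : u \notin A -> N u v = X u v.
  move=> uA; apply: tE; apply/eqP.
  have := psumr_eq0P (fun w _ => t_ge0 u w _) (t_sum u).
  by move=> -> // w; rewrite (negPf uA).
(* Row [v] of [N] is already known, so by symmetry of the support [uv] is an edge of [N]: the
   deficit is 0 or a full sign change. *)
have t_ge0_in u v : u \in A -> v \notin A -> t u v = 0 \/ t u v = 2.
  move=> uA vA; have uv : (u == v) = false by apply: contraNF vA => /eqP<-.
  have := NXout v u vA; rewrite /t !mxE [v == u]eq_sym uv (negPf vA) andbF /= => Nvu.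
  have := Nval u v; rewrite !inE Nsym Nvu signr_eq0 /= => /orP[]/eqP->;
  by case: (s u); solve [by left | by right].
have NXin u v : u \in A -> N u v = X u v.
  move=> uA; have : #|A| = 2%N.
    by case/orP: hA => /eqP // A0; move: uA; rewrite (cards0_eq A0) inE.
  move=> /eqP/cards2P[x [y [xy AE]]].
  have [w uw {x y xy}AE] : exists2 w, u != w & A = [set u; w]%SET.
    move: uA; rewrite AE !inE => /orP[]/eqP->; first by exists y.
    by exists x; rewrite 1?eq_sym // finset.setUC.
  have tuu : t u u = 0 by rewrite /t Ndiag mxE eqxx subrr mulr0.
  (* Only the entry at [w] can be negative, and it is at least -1, so it cannot offset a deficit of
     2 elsewhere in the row. *)
  have t0 x : x != w -> t u x = 0.
    have [-> //|xu xw] := eqVneq x u.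
    have xA : x \notin A by rewrite AE !inE negb_or xu.
    have [// | tx2] := t_ge0_in u x uA xA.
    have := t_sum u; rewrite (bigD1 x) // (bigD1 w) 1?eq_sym //= tx2.
    have : 0 <= \sum_(i < n | (i != x) && (i != w)) t u i.
      apply: sumr_ge0 => i /andP[_ iw]; have [->|iu] := eqVneq i u; first by rewrite tuu.
      by apply: t_ge0; rewrite uA AE !inE negb_or iu.
    have : -1 <= t u w.
      rewrite /t mxE uA AE !inE eqxx orbT orbT sub0r.
      by have := Nval u w; rewrite !inE => /or3P[]/eqP->; case: (s u).
    by move: (t u w) (\sum_(i < n | _) _) => a b; lia.
  apply: tE; have [->|/t0 //] := eqVneq v w.
  by have := t_sum u; rewrite (bigD1 w) //= big1 ?addr0.
by apply/matrixP => u v; have [/NXin|/NXout] := boolP (u \in A).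
Qed.

(** For [n > 2] the absolute values [n - 1] and [n - 2] are distinct and positive, so each entry
    reveals both its sign and membership in [A]. *)
Lemma extremal_seq_inj (n : nat) (s s' : {ffun 'I_n -> bool}) (A A' : {set 'I_n}) :
  (2 < n)%N -> extremal_seq s A = extremal_seq s' A' -> s = s' /\ A = A'.
Proof.
move=> n2 /rowP E.
suff H u : s u = s' u /\ (u \in A) = (u \in A').
  by split; [apply/ffunP => u|apply/setP => u]; have [] := H u.
have := E u; rewrite !mxE.
by case: (s u); case: (s' u); case: (u \in A); case: (u \in A') => //=; lia.
Qed.

(** * Counting the sequences *)

Lemma card_empty_or_pair (n : nat) : #|[set A | @empty_or_pair n A]%SET| = ('C(n, 2) + 1)%N.
Proof.
have -> : [set A | @empty_or_pair n A]%SET =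
    (finset.set0 |: [set A : {set 'I_n} | #|A| == 2%N])%SET.
  by apply/setP => A; rewrite !inE /empty_or_pair cards_eq0.
by rewrite cardsU1 card_draws card_ord inE cards0 addnC.
Qed.

End HalfEdgeMatrices.

Theorem corollary4p9 (n : nat) (hn : 2 < n) :
  [set d : 'rV[int]_n | uniquely_realizable d] #= `I_(2 ^ n * 'C(n, 2) + 2 ^ n).
Proof.
pose K := [set p : {ffun 'I_n -> bool} * {set 'I_n} | empty_or_pair p.2]%SET.
have cardK : #|K| = (2 ^ n * 'C(n, 2) + 2 ^ n)%N.
  rewrite -[X in (_ + X)%N]muln1 -mulnDr -card_empty_or_pair.
  rewrite -[X in (2 ^ X)%N](card_ord n) -card_bool -card_ffun -cardsT -cardsX.
  by apply: eq_card => p; rewrite !inE.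
(* Enumerating [K] by ordinals presents the sequences as an injective image of a type with [#|K|]
   elements. *)
rewrite -cardK; pose g (i : 'I_#|K|) := extremal_seq (enum_val i).1 (enum_val i).2.
have -> : [set d : 'rV[int]_n | uniquely_realizable d] = g @` [set: 'I_#|K|].
  apply/seteqP; split=> [d /uniquely_realizableP [M Muniq <-]|_ [i _ <-]] /=.
    have [s [A [hA ->]]] := realizes_uniquely_extremal Muniq.
    have pK : (s, A) \in K by rewrite inE.
    exists (enum_rank_in pK (s, A)) => //.
    by rewrite /g enum_rankK_in // row_sums_extremal.
  have := enum_valP i; rewrite inE => hA.
  apply/uniquely_realizableP; exists (extremal_mx (enum_val i).1 (enum_val i).2).
    exact: extremal_realizes_uniquely.
  exact: row_sums_extremal.
apply: (card_eq_trans (inj_card_eq _)); last by rewrite card_eq_sym card_II.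
move=> i j _ _ /(extremal_seq_inj hn) [E1 E2]; apply: enum_val_inj.
by rewrite [LHS]surjective_pairing E1 E2 -surjective_pairing.
Qed.
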